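(* Let $G$ be an abelian group (written multiplicatively) and let $A$ and $B$ be nonempty finite subsets of $G$ with $|A| = |B|$. Then the pair $(A,B)$ is unmatchable if and only if there exists a nonempty subset $R$ of $B$ such that $A$ and $B$ can be expressed as disjoint unions $$A = S \cup Y, \qquad B = R \cup Z,$$ where $S$ is a disjoint union of cosets of $\langle R \rangle$, and $Y$ satisfies $|Y| < |R|$.
   Context: For nonempty finite subsets $A,B$ of an abelian group $G$ with $|A|=|B|$, a matching from $A$ to $B$ is a bijection $f:A\to B$ such that $af(a)\notin A$ for all $a\in A$. The pair $(A,B)$ is matchable if at least one matching from $A$ to $B$ exists, and unmatchable otherwise. For a subset $X\subseteq G$, $\langle X\rangle$ denotes the subgroup of $G$ generated by $X$. *)

(* Defs.v *)
From mathcomp Require Import all_boot finmap.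
From mathcomp Require Import boolp classical_sets.

Set Implicit Arguments.
Unset Strict Implicit.
Unset Printing Implicit Defensive.

Local Open Scope fset_scope.
Local Open Scope classical_set_scope.
Local Open Scope group_scope.

Section Matchings.
Context {G : groupType}.
Implicit Types (A B S Y : {fset G}) (H X : set G).

(* A finite set coerces to the type of its elements, so f is a map defined on
   A only, with values in B. *)
Definition is_matching A B (f : A -> B) : Prop :=
  bijective f /\ forall a : A, val a * val (f a) \notin A.

Definition matchable A B : Prop := exists f : A -> B, is_matching f.

Definition unmatchable A B : Prop := ~ matchable A B.

Definition is_subgroup H : Prop := group_closed [in H].

(* The subgroup generated by X may be infinite, even when X is finite. *)
Definition generated_subgroup X : set G := smallest is_subgroup X.

Definition cosets H : set (set G) := [set [set x * h | h in H] | x in [set: G]].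

Definition disjoint_union_of_cosets H X : Prop :=
  exists C : set (set G),
    [/\ C `<=` cosets H, trivIset C id & X = \bigcup_(D in C) D].

Definition is_disjoint_union A S Y : Prop :=
  A = (S `|` Y)%fset /\ [disjoint S & Y]%fset.

End Matchings.

(* Main.v *)
Require Import Defs.
From mathcomp Require Import all_boot finmap.
From mathcomp Require Import boolp classical_sets.

(** If [(A, B)] is unmatchable, Hall's theorem gives a nonempty [R] in [B] such
    that [S = {a in A | a R is contained in A}] satisfies [#|A| < #|S| + #|R|].
    For [s] in [S], the e-transform of Dyson replaces [(S, R)] by the pair
    [(S `|` s R, R `&` s^-1 S)], which keeps [#|S| + #|R|] and the inclusions
    of [S] and [S R] in [A]; as [#|S `|` s R| <= #|A|], its second component
    stays nonempty. When [#|R|] is minimal, [s R] is therefore contained in [S]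
    for every [s] in [S], and [S], being finite, is stable under [<R>].
    Conversely, if [S] is stable under [<R>], then a matching must pair the
    elements of [R] with elements of [Y], which is too small. *)

(* Rado's proof: by submodularity of [X |-> #|\bigcup_(x in X) F x|], one of any
   two elements of [F x] can be removed without violating Hall's condition. *)
Lemma hall_marriage (T U : finType) (F : T -> {set U}) :
  (forall X : {set T}, #|X| <= #|(\bigcup_(x in X) F x)%SET|) ->
  exists2 f : T -> U, injective f & forall x, f x \in F x.
Proof.
have [n] := ubnP (\sum_x #|F x|); elim: n F => // n IHn F leFn hallF.
pose N (X : {set T}) := (\bigcup_(x in X) F x)%SET.
(* Hall's condition on singletons makes every [F x] a singleton, and on pairs it makes these
   singletons distinct. *)
have [/forallP F_le1|] := boolP [forall x, #|F x| <= 1].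
  have /fin_all_exists[f Ff] x : exists u, F x = [set u]%SET.
    apply/cards1P; rewrite eqn_leq F_le1.
    by have := hallF [set x]%SET; rewrite cards1 big_set1.
  exists f => [x y fxy|x]; last by rewrite Ff set11.
  apply/eqP/negPn/negP => neq_xy; have := hallF [set x; y]%SET.
  rewrite cards2 neq_xy finset.bigcup_setU !big_set1 !Ff fxy.
  by rewrite finset.setUid cards1.
case/forallPn=> x; rewrite -ltnNge => /card_gt1P[y1 [y2 [Fy1 Fy2 neq_y]]].
(* Either Hall's condition survives the removal of [y] and the induction applies, or it fails at
   some set, which must contain [x]; [Z] is that set without [x]. *)
have shrink y : y \in F x ->
    (exists2 f : T -> U, injective f & forall x, f x \in F x) \/
    exists Z : {set T}, x \notin Z /\ #|(F x :\ y :|: N Z)%SET| <= #|Z|.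
  move=> Fxy; pose F' z := if z == x then (F x :\ y)%SET else F z.
  have subF z : F' z \subset F z.
    by rewrite /F'; case: eqP => // ->; apply: finset.subD1set.
  have F'N (X : {set T}) : x \notin X -> (\bigcup_(z in X) F' z)%SET = N X.
    move=> xX; apply: eq_bigr => z zX; rewrite /F'; case: eqP => // zx.
    by rewrite zx (negPf xX) in zX.
  have [hallF'|] := pselect (forall X : {set T},
      #|X| <= #|(\bigcup_(x in X) F' x)%SET|).
    left; have [|f f_inj F'f] := IHn F' _ hallF'.
      rewrite -ltnS; apply: leq_trans leFn; rewrite ltnS.
      rewrite (bigD1 x) //= [in leqRHS](bigD1 x) //=.
      rewrite -addSn leq_add //; first by rewrite /F' eqxx (cardsD1 y (F x)) Fxy.
      by apply: leq_sum => z _; apply/subset_leq_card.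
    by exists f => // z; have /fintype.subsetP := subF z; apply.
  case/existsNP=> X /negP; rewrite -ltnNge => ltX; right.
  have xX : x \in X.
    by apply: contraLR ltX => xX; rewrite -leqNgt F'N.
  exists (X :\ x)%SET; split; first by rewrite !inE eqxx.
  move: ltX; rewrite (cardsD1 x X) xX add1n ltnS (big_setD1 x) //=.
  by rewrite F'N ?inE ?eqxx // {1}/F' eqxx.
have [//|[Z1 [xZ1 leZ1]]] := shrink _ Fy1.
have [//|[Z2 [xZ2 leZ2]]] := shrink _ Fy2.
set N1 := (_ :|: _)%SET in leZ1; set N2 := (_ :|: _)%SET in leZ2.
(* As [y1 != y2], all of [F x] is covered: each element differs from [y1] or from [y2]. *)
have subU : (N (x |: (Z1 :|: Z2)) \subset N1 :|: N2)%SET.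
  apply/fintype.subsetP => u; rewrite /N !finset.bigcup_setU big_set1 !inE.
  rewrite -!/(N _); case: (u \in N Z1); first by rewrite !orbT.
  case: (u \in N Z2); first by rewrite !orbT.
  rewrite !orbF => -> /=; rewrite !andbT.
  by apply/orP; have [->|] := eqVneq u y1; [right|left].
have subI : (N (Z1 :&: Z2) \subset N1 :&: N2)%SET.
  apply/fintype.subsetP => u /bigcupP[z]; rewrite inE => /andP[zZ1 zZ2] Fzu.
  rewrite !inE; apply/andP; split; apply/orP; right; apply/bigcupP.
    by exists z.
  by exists z.
(* Hall's condition on [x |: (Z1 :|: Z2)] and on [Z1 :&: Z2] gives [#|Z1| + #|Z2| < #|N1| + #|N2|],
   against [leZ1] and [leZ2]. *)
have := leq_trans (hallF _) (subset_leq_card subU).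
rewrite cardsU1 !inE (negPf xZ1) (negPf xZ2) add1n => leU.
have leI := leq_trans (hallF _) (subset_leq_card subI).
have := leq_add leU leI; rewrite addSn !cardsUI.
by rewrite ltnNge leq_add.
Qed.

Section Dyson.
Context {G : groupType}.
Local Open Scope group_scope.

Lemma card_translate (R : {fset G}) (s : G) :
  #|` [fset s * r | r in R]%fset| = #|` R|.
Proof. by rewrite card_imfset //; apply: mulgI. Qed.

Lemma dyson_stable_pair (abelG : forall x y : G, commute x y)
    (A S R : {fset G}) :
    R != fset0 -> fsubset S A -> (#|` A| < #|` S| + #|` R|)%N ->
    {in S & R, forall s r, s * r \in A} ->
  exists S' R' : {fset G},
    [/\ R' != fset0, fsubset R' R, fsubset S' A,
        (#|` A| < #|` S'| + #|` R'|)%N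
      & {in S' & R', forall s r, s * r \in S'}].
Proof.
have [n] := ubnP #|` R|; elim: n S R => // n IHn S R leRn R0 sSA ltA SRA.
have [stable|] := pselect {in S & R, forall s r, s * r \in S}.
  by exists S, R; split.
case/existsNP=> s /existsNP[r0 /not_implyP[sS /not_implyP[r0R /negP sr0S]]].
pose sR := [fset s * r | r in R]%fset.
pose S1 := (S `|` sR)%fset; pose R1 := [fset r in R | s * r \in S]%fset.
have sS1A : fsubset S1 A.
  rewrite fsubUset sSA; apply/fsubsetP => x /imfsetP[r /= rR ->].
  exact: SRA.
have sR1R : fsubset R1 R by apply: fset_sub.
(* Inclusion-exclusion for [S] and [sR], whose intersection is the translate of [R1] by [s]. *)
have cardE : (#|` S1| + #|` R1| = #|` S| + #|` R|)%N.
  rewrite -(card_translate R s) -(cardfsUI S); congr addn.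
  rewrite -(card_translate R1 s); congr #|` _|; apply/fsetP => x.
  rewrite inE; apply/imfsetP/andP => [[r /=]|[xS /imfsetP[r /= rR xE]]].
    rewrite !inE => /andP[rR srS] ->; split=> //.
    by apply/imfsetP; exists r.
  by exists r => //=; rewrite !inE rR -xE.
have R1_neq0 : R1 != fset0.
  apply: contraTneq ltA => R10; rewrite -leqNgt -cardE R10 cardfs0 addn0.
  exact: fsubset_leq_card.
have ltR1 : (#|` R1| < #|` R|)%N.
  apply: fproper_ltn_card; rewrite fproperE sR1R.
  by apply/fsubsetPn; exists r0 => //; rewrite !inE (negPf sr0S) andbF.
have [|||||S' [R' [? sR'R1 ? ? ?]]] := IHn S1 R1 => //.
- exact: leq_trans ltR1 _.
- by rewrite cardE.
(* Commutativity enters here: [s * r' * r = (s * r) * r'], where [s * r] is in [S]. *)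
- move=> x r; rewrite !inE => xS1 /andP[rR srS].
  case/orP: xS1 => [xS|/imfsetP[r' /= r'R ->]]; first exact: SRA.
  by rewrite -mulgA (abelG r' r) mulgA; apply: SRA.
by exists S', R'; split=> //; apply: fsubset_trans sR1R.
Qed.

(** Translation by [y] maps the finite set [S] injectively into itself, hence onto, so [y^-1]
    stabilizes [S] too. *)
Lemma stabilizer_subgroup (S : {fset G}) :
  is_subgroup [set h | {in S, forall s, s * h \in S}]%classic.
Proof.
split; first by rewrite inE /= => s; rewrite mulg1.
move=> x y; rewrite !inE /= => Sx Sy s sS.
have : [fset t * y | t in S]%fset = S.
  apply/eqP; rewrite eqEfcard card_imfset ?leqnn ?andbT; last exact: mulIg.
  by apply/fsubsetP => u /imfsetP[t /= tS ->]; apply: Sy.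
move=> Sy_eq; have := Sx s sS; rewrite -{1}Sy_eq => /imfsetP[t /= tS eq_t].
by rewrite mulgA eq_t mulgK.
Qed.

Lemma generated_subgroup_group_closed (X : set G) :
  is_subgroup (generated_subgroup X).
Proof.
split; first by rewrite inE => H [[H1 _] _]; have := H1; rewrite inE.
move=> x y; rewrite !inE => Xx Xy H [gH sXH].
have [_ Hdiv] := gH; have := Hdiv x y; rewrite !inE.
by apply; [apply: Xx|apply: Xy].
Qed.

Lemma stable_union_of_cosets (R S : {fset G}) :
  {in S & R, forall s r, s * r \in S} <->
  disjoint_union_of_cosets (generated_subgroup [set` R]) [set` S].
Proof.
set H := generated_subgroup _; have gH : is_subgroup H.
  exact: generated_subgroup_group_closed.
have H1 : H 1 by have [] := gH; rewrite inE.
have HV x : H x -> H x^-1.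
  move=> Hx; have [_ /(_ 1 x)] := gH; rewrite !inE mul1g; exact.
have HM x y : H x -> H y -> H (x * y).
  move=> Hx Hy; have [_ /(_ x y^-1)] := gH; rewrite !inE invgK.
  by apply=> //; apply: HV.
split=> [stable|[C [CH _ SE]] s r sS rR].
  have sHS s h : s \in S -> H h -> s * h \in S.
    move=> sS Hh; apply: (smallest_sub (stabilizer_subgroup S) _ Hh) => //.
    by move=> r /= rR t tS; apply: stable.
  (* As a set of cosets, the family keeps one copy of a coset that comes from several [s]. *)
  exists [set [set s * h | h in H] | s in [set` S]]%classic; split.
  - by move=> _ [s _ <-]; exists s.
  - move=> _ _ [s _ <-] [t _ <-] [_ [[h Hh <-] [k Hk tk]]].
    have eq_t : t = s * (h * k^-1) by rewrite mulgA -tk mulgK.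
    rewrite eq_t; apply/seteqP; split=> _ [l Hl <-] /=.
      exists (k * h^-1 * l); first by apply: (HM); [apply: HM=> //; apply: HV|].
      by rewrite -!mulgA mulKg mulVKg.
    exists (h * k^-1 * l); first by apply: (HM); [apply: HM=> //; apply: HV|].
    by rewrite !mulgA.
  apply/seteqP; split=> [s /= sS|_ [_ [s /= sS <-] [h Hh <-]] /=].
    by exists [set s * h | h in H]%classic; [exists s|exists 1; rewrite ?mulg1].
  exact: sHS.
have : [set` S]%classic s by [].
rewrite SE => -[D CD Ds]; suff : [set` S]%classic (s * r) by [].
rewrite SE; exists D => //; have [x _ xD] := CH D CD.
move: Ds; rewrite -xD => -[h Hh <-]; exists (h * r); rewrite ?mulgA //.
by apply: HM => // K [_]; apply.
Qed.

Lemma unmatchable_deficiency (A B : {fset G}) : #|` A| = #|` B| ->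
  unmatchable A B ->
  exists S R : {fset G},
    [/\ fsubset S A, fsubset R B, (#|` A| < #|` S| + #|` R|)%N
      & {in S & R, forall s r, s * r \in A}].
Proof.
move=> eqAB noAB.
(* Hall's theorem is applied from [B] to [A], so a matching is the inverse of the injection
   found. *)
pose F (b : B) : {set A} := [set a : A | val a * val b \notin A]%SET.
have [hallF|/existsNP[X /negP]] := pselect (forall X : {set B},
    #|X| <= #|(\bigcup_(b in X) F b)%SET|)%N.
  have [g g_inj Fg] := hall_marriage _ _ _ hallF.
  have [|f gK fK] := inj_card_bij g_inj; first by rewrite -!cardfE eqAB.
  case: noAB; exists f; split=> [|a]; first by exists g.
  by have := Fg (f a); rewrite inE fK.
rewrite -ltnNge; set N := (\bigcup_(_ in _) _)%SET => ltN.
(* An [a] outside the neighbourhood [N] of the violating set [X] satisfies [a * b \in A] for every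
   [b] in [X]. *)
exists [fset val a | a in (~: N)%SET]%fset, [fset val b | b in X]%fset; split.
- by apply/fsubsetP => _ /imfsetP[a _ ->]; apply: valP.
- by apply/fsubsetP => _ /imfsetP[b _ ->]; apply: valP.
- rewrite !card_imfset /=; try exact: val_inj.
  by rewrite -!cardE cardfE -(cardsC N) addnC ltn_add2l.
move=> _ _ /imfsetP[a /= aN ->] /imfsetP[b /= bX ->].
apply: contraLR aN => abA; rewrite inE negbK; apply/bigcupP.
by exists b; rewrite ?inE.
Qed.

Lemma matching_preimage_card (A B S Y R : {fset G}) :
    is_disjoint_union A S Y -> fsubset R B ->
    {in S & R, forall s r, s * r \in S} -> matchable A B ->
  (#|` R| <= #|` Y|)%N.
Proof.
move=> [AE _] /fsubsetP sRB stable [f [[g fK gK] fA]].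
(* [h] extends the inverse matching [g] to [G]; its default value is never met, as [R] lies in
   [B]. *)
pose h r := if insub r is Some b then val (g b) else r.
have hE b : h (val b) = val (g b) by rewrite /h valK.
have <- : #|` [fset h r | r in R]%fset| = #|` R|.
  apply: card_in_imfset => x y /= xR yR.
  rewrite -[x]/(val [` sRB x xR]%fset) -[y]/(val [` sRB y yR]%fset) !hE.
  by move=> /val_inj/(can_inj gK) ->.
apply/fsubset_leq_card/fsubsetP => _ /imfsetP[r /= rR ->].
rewrite -[r]/(val [` sRB r rR]%fset) hE; set b := [` _]%fset.
have A_SY x : (x \in A) = (x \in S) || (x \in Y) by rewrite AE inE.
(* If [g b] were in [S], stability would put [g b * b] in [S], hence in [A]. *)
have := valP (g b); rewrite A_SY => /orP[gS|//].
by have := fA (g b); rewrite gK A_SY stable.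
Qed.

End Dyson.

Theorem theorem2p3 (G : groupType) (abelG : forall x y : G, commute x y)
    (A B : {fset G}) (A_neq0 : A != fset0) (B_neq0 : B != fset0)
    (eq_cardAB : #|` A| = #|` B|) :
  unmatchable A B <->
  exists R : {fset G},
    [/\ R != fset0, fsubset R B &
      exists S Y Z : {fset G},
        [/\ is_disjoint_union A S Y,
            is_disjoint_union B R Z,
            disjoint_union_of_cosets (generated_subgroup [set` R]) [set` S] &
            #|` Y| < #|` R|]].
Proof.
have splitD (X V : {fset G}) :
    fsubset V X -> is_disjoint_union X V (X `\` V)%fset.
  move=> /fsubsetP sVX; split; last by apply/fdisjointP => x xV; rewrite inE xV.
  by apply/fsetP => x; rewrite !inE; have [/sVX|] := boolP (x \in V).
split=> [/(unmatchable_deficiency _ _ eq_cardAB)[S [R [sSA sRB ltA SRA]]]|].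
  have R_neq0 : R != fset0.
    apply: contraTneq ltA => ->; rewrite cardfs0 addn0 -leqNgt.
    exact: fsubset_leq_card.
  have [S' [R' [R'0 sR'R sS'A ltA' stable]]] :=
    dyson_stable_pair abelG _ _ _ R_neq0 sSA ltA SRA.
  have sR'B := fsubset_trans sR'R sRB.
  exists R'; split=> //; exists S', (A `\` S')%fset, (B `\` R')%fset.
  split; [exact: splitD|exact: splitD|exact/stable_union_of_cosets|].
  by rewrite cardfsDS // ltn_subLR // fsubset_leq_card.
move=> [R [_ sRB [S [Y [Z [AE _ /stable_union_of_cosets stable ltYR]]]]]].
move=> /(matching_preimage_card _ _ _ _ _ AE sRB stable).
by rewrite leqNgt ltYR.
Qed.
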